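(* Let $\mathcal{A}$ be a central hyperplane arrangement in $V=\mathbb{K}^n$ of rank $r$ with intersection lattice $L(\mathcal{A})$. Let $\mathcal{C}\colon V=X_0<X_1<\dots<X_r=T$ be a maximal chain of $L(\mathcal{A})$, and let $\pi=\{\pi_1,\ldots,\pi_r\}$ be the set partition of $\mathcal{A}$ defined by $\pi_i=\mathcal{A}_{X_i}\setminus\mathcal{A}_{X_{i-1}}$ for $i=1,\ldots,r$. Then $\pi$ is a nice partition if and only if $\mathcal{C}$ is a modular chain.
   Context: $\mathbb{K}$ is a field. A hyperplane arrangement is a finite set of hyperplanes in $V=\mathbb{K}^n$; central means all the hyperplanes contain $0$. $L(\mathcal{A})$ is the set of all intersections of hyperplanes in $\mathcal{A}$ (including $V$ as the empty intersection), ordered by reverse inclusion. Its minimum is $V$ and its maximum is $T=\bigcap_{H\in\mathcal{A}}H$. It is a geometric lattice with rank function $r(X)=n-\dim X$, and the rank of $\mathcal{A}$ is $r=r(T)$. Join is $X\vee Y=X\cap Y$ and meet $X\wedge Y$ is the intersection of all $Z\in L(\mathcal{A})$ with $X,Y\subseteq Z$. For $X\in L(\mathcal{A})$, the localization is $\mathcal{A}_X=\{H\in\mathcal{A}\mid X\subseteq H\}$. An element $X\in L(\mathcal{A})$ is modular if $r(X)+r(Y)=r(X\vee Y)+r(X\wedge Y)$ for all $Y\in L(\mathcal{A})$. The chain $\mathcal{C}$ is a modular chain if every $X_i$ is modular. Let $\pi=\{\pi_1,\dots,\pi_l\}$ be a set partition of $\mathcal{A}$ (pairwise disjoint nonempty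 parts with union $\mathcal{A}$; unordered). A $p$-section of $\pi$ ($p\ge 0$) is a $p$-tuple $(H_1,\dots,H_p)$ of hyperplanes of $\mathcal{A}$ such that $H_a$ and $H_b$ lie in different parts of $\pi$ whenever $a\ne b$ (the empty tuple is the $0$-section). A $p$-tuple is independent if $r(\bigcap_{i=1}^pH_i)=p$; $\pi$ is independent if all its $p$-sections, for all $p\ge0$, are independent. The partition $\pi$ is nice if it is independent and for every $X\in L(\mathcal{A})\setminus\{V\}$ there is some $i$ with $|\pi_i\cap\mathcal{A}_X|=1$. *)

(* Defs.v *)
From mathcomp Require Import all_boot all_order all_algebra finmap.

Set Implicit Arguments.
Unset Strict Implicit.
Unset Printing Implicit Defensive.

Import GRing.Theory.

Local Open Scope fset_scope.
Local Open Scope nat_scope.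

(* The hyperplanes of a central arrangement contain 0, so they are linear
   subspaces of 'rV[K]_n.  Writing (\dim H).+1 = n rather than \dim H = n.-1
   excludes the zero space when n = 0. *)
Definition central_arrangement (K : fieldType) (n : nat)
    (A : {fset {vspace 'rV[K]_n}}) : Prop :=
  forall H, H \in A -> (\dim H).+1 = n.

Definition lattice (K : fieldType) (n : nat)
    (A : {fset {vspace 'rV[K]_n}}) : {fset {vspace 'rV[K]_n}} :=
  [fset (\bigcap_(H <- enum_fset B) H)%VS | B : {fset {vspace 'rV[K]_n}} in fpowerset A].

(* Reverse inclusion. *)
Definition lat_le (K : fieldType) (n : nat) (X Y : {vspace 'rV[K]_n}) : bool :=
  (Y <= X)%VS.

Definition lat_lt (K : fieldType) (n : nat) (X Y : {vspace 'rV[K]_n}) : bool :=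
  lat_le X Y && (X != Y).

Definition lat_top (K : fieldType) (n : nat)
    (A : {fset {vspace 'rV[K]_n}}) : {vspace 'rV[K]_n} :=
  (\bigcap_(H <- enum_fset A) H)%VS.

Definition lat_join (K : fieldType) (n : nat) (X Y : {vspace 'rV[K]_n}) :
    {vspace 'rV[K]_n} :=
  (X :&: Y)%VS.

Definition lat_meet (K : fieldType) (n : nat)
    (A : {fset {vspace 'rV[K]_n}}) (X Y : {vspace 'rV[K]_n}) :
    {vspace 'rV[K]_n} :=
  (\bigcap_(Z <- enum_fset (lattice A) | (X <= Z)%VS && (Y <= Z)%VS) Z)%VS.

Definition rk (K : fieldType) (n : nat) (X : {vspace 'rV[K]_n}) : nat :=
  n - \dim X.

Definition arr_rank (K : fieldType) (n : nat)
    (A : {fset {vspace 'rV[K]_n}}) : nat :=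
  rk (lat_top A).

Definition localization (K : fieldType) (n : nat)
    (A : {fset {vspace 'rV[K]_n}}) (X : {vspace 'rV[K]_n}) :
    {fset {vspace 'rV[K]_n}} :=
  [fset H in A | (X <= H)%VS].

Definition modular (K : fieldType) (n : nat)
    (A : {fset {vspace 'rV[K]_n}}) (X : {vspace 'rV[K]_n}) : Prop :=
  X \in lattice A /\
  forall Y, Y \in lattice A ->
    rk X + rk Y = rk (lat_join X Y) + rk (lat_meet A X Y).

Definition chain (K : fieldType) (n : nat) (A : {fset {vspace 'rV[K]_n}})
    (r : nat) (C : 'I_r.+1 -> {vspace 'rV[K]_n}) : Prop :=
  (forall i, C i \in lattice A) /\
  (forall i j : 'I_r.+1, i < j -> lat_lt (C i) (C j)).

(* The last clause says that no element of the lattice can be added to C. *)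
Definition maximal_chain (K : fieldType) (n : nat)
    (A : {fset {vspace 'rV[K]_n}}) (r : nat)
    (C : 'I_r.+1 -> {vspace 'rV[K]_n}) : Prop :=
  chain A C /\
  forall Z, Z \in lattice A ->
    (forall i, lat_le Z (C i) || lat_le (C i) Z) -> exists i, Z = C i.

Definition modular_chain (K : fieldType) (n : nat)
    (A : {fset {vspace 'rV[K]_n}}) (r : nat)
    (C : 'I_r.+1 -> {vspace 'rV[K]_n}) : Prop :=
  forall i, modular A (C i).

Definition set_partition (K : fieldType) (n : nat)
    (A : {fset {vspace 'rV[K]_n}}) (P : {fset {fset {vspace 'rV[K]_n}}}) :
    Prop :=
  [/\ forall B, B \in P -> B != fset0,
      forall B B', B \in P -> B' \in P -> B != B' -> B `&` B' = fset0
    & \bigcup_(B <- enum_fset P) B = A].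

Definition section (K : fieldType) (n : nat)
    (A : {fset {vspace 'rV[K]_n}}) (P : {fset {fset {vspace 'rV[K]_n}}})
    (p : nat) (s : p.-tuple {vspace 'rV[K]_n}) : Prop :=
  (forall a, tnth s a \in A) /\
  forall a b : 'I_p, a != b ->
    exists B B', [/\ B \in P, B' \in P, B != B', tnth s a \in B
                   & tnth s b \in B'].

Definition independent_tuple (K : fieldType) (n p : nat)
    (s : p.-tuple {vspace 'rV[K]_n}) : Prop :=
  rk (\bigcap_(i < p) tnth s i)%VS = p.

Definition independent_partition (K : fieldType) (n : nat)
    (A : {fset {vspace 'rV[K]_n}}) (P : {fset {fset {vspace 'rV[K]_n}}}) :
    Prop :=
  forall (p : nat) (s : p.-tuple {vspace 'rV[K]_n}),
    section A P s -> independent_tuple s.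

Definition nice_partition (K : fieldType) (n : nat)
    (A : {fset {vspace 'rV[K]_n}}) (P : {fset {fset {vspace 'rV[K]_n}}}) :
    Prop :=
  [/\ set_partition A P,
      independent_partition A P
    & forall X, X \in lattice A -> X != fullv ->
        exists2 B, B \in P & #|` B `&` localization A X| = 1].

(* i : 'I_r stands for i + 1 in 1..r: lift ord0 i has value i + 1 and
   widen_ord (leqnSn r) i has value i. *)
Definition chain_part (K : fieldType) (n : nat)
    (A : {fset {vspace 'rV[K]_n}}) (r : nat)
    (C : 'I_r.+1 -> {vspace 'rV[K]_n}) (i : 'I_r) :
    {fset {vspace 'rV[K]_n}} :=
  localization A (C (lift ord0 i)) `\`
  localization A (C (widen_ord (leqnSn r) i)).

Definition chain_partition (K : fieldType) (n : nat)
    (A : {fset {vspace 'rV[K]_n}}) (r : nat)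
    (C : 'I_r.+1 -> {vspace 'rV[K]_n}) :
    {fset {fset {vspace 'rV[K]_n}}} :=
  [fset chain_part A C i | i : 'I_r].

(* Main.v *)
Require Import Defs.
From mathcomp Require Import all_boot all_order all_algebra finmap.
From mathcomp Require Import zify.

(** Write A_X for the hyperplanes of A containing X, and call the part of index
    i of the chain the set of hyperplanes that contain X_(i+1) but not X_i.

    The parts always form an independent partition. Each X_i is an intersection
    of hyperplanes, so every strict step of the chain acquires some hyperplane,
    which makes the parts nonempty. Intersect the members of a section by
    increasing part index: what has been intersected before a member H of index
    i contains X_i, which H does not contain, so each member lowers the
    dimension by one ([section_independent]). Hence niceness reduces to its
    singleton condition, that A_Y meets some part in one hyperplane for every
    flat Y other than the whole space, and that is equivalent to modularity.

    Modular implies singleton ([modular_flag_singleton]). Given a flat Y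
    distinct from the whole space, take the first part i meeting A_Y. No
    hyperplane contains both X_i and Y, so their meet has rank 0; comparing the
    modular equations of X_i and X_(i+1) against Y, the meet of X_(i+1) and Y
    has rank at most 1. It lies in every hyperplane of the part i that contains
    Y, so there is only one such hyperplane.

    Singleton implies modular, through an exchange property [flag_exchange]: for
    two distinct hyperplanes H, H' of the part i, some hyperplane containing X_i
    contains their intersection. The singleton part of the rank two flat
    [H :&: H'] provides it ([singleton_flag_exchange]). The exchange property
    makes all hyperplanes of one part that contain a flat Y cut the same
    subspace out of the meet of X_i and Y, so going from X_i to X_(i+1) this
    meet is either unchanged or cut by a single hyperplane of the part
    ([lat_meet_step]). Now fix X_i and let m grow from i to r. Whenever the rank
    of the meet of X_m and Y grows, by one, so does the rank of its intersection
    with X_i, because this intersection contains X_m, which the new hyperplane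
    does not contain. At m = r the meet is Y, and this is the inequality that
    semimodularity lacks ([exchange_flag_modular]). *)

Set Implicit Arguments.
Unset Strict Implicit.
Unset Printing Implicit Defensive.

Local Open Scope fset_scope.
Local Open Scope nat_scope.

(** * Ranks and hyperplanes *)

Section Hyperplanes.

Variables (K : fieldType) (n : nat).
Implicit Types U V H : {vspace 'rV[K]_n}.

Lemma dim_fullrV : \dim (fullv : {vspace 'rV[K]_n}) = n.
Proof. by rewrite dimvf dim_matrix; exact: mul1n. Qed.

Lemma dim_le U : \dim U <= n.
Proof. by rewrite -[leqRHS]dim_fullrV dimvS ?subvf. Qed.

Lemma rkK U : rk U + \dim U = n.
Proof. by rewrite /rk subnK ?dim_le. Qed.

Lemma rk_sub U V : (U <= V)%VS -> rk V <= rk U.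
Proof. by move=> /dimvS UV; rewrite leq_sub2l. Qed.

Lemma rk_fullv : rk (fullv : {vspace 'rV[K]_n}) = 0.
Proof. by rewrite /rk dim_fullrV subnn. Qed.

Lemma hyperplane_neq_fullv H : (\dim H).+1 = n -> ~~ (fullv <= H)%VS.
Proof. by move=> hH; apply/negP => /dimvS; rewrite dim_fullrV; lia. Qed.

Lemma rk_cap_hyperplane U H : (\dim H).+1 = n ->
  rk (U :&: H)%VS = rk U + ~~ (U <= H)%VS.
Proof.
move=> hH; case: (boolP (U <= H)%VS) => [/capv_idPl -> | nUH]; first lia.
have := dimv_sum_cap U H; have := rkK U; have := rkK (U :&: H)%VS.
suff: \dim (U + H)%VS = n by lia.
have: \dim H < \dim (U + H)%VS.
  rewrite ltn_neqAle dimvS ?addvSr // andbT.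
  apply: contra nUH => /eqP dE.
  suff /eqP ->: (H == (U + H)%VS) by rewrite addvSl.
  by rewrite eqEdim addvSr dE leqnn.
have := dim_le (U + H)%VS; lia.
Qed.

Lemma hyperplane_inj H H' : (\dim H).+1 = n -> (\dim H').+1 = n ->
  (H <= H')%VS -> H = H'.
Proof. by move=> hH hH' HH'; apply/eqP; rewrite eqEdim HH' /=; lia. Qed.

Lemma hyperplane_eq U H : (\dim H).+1 = n -> rk U <= 1 -> (U <= H)%VS -> U = H.
Proof.
by move=> hH rkU UH; apply/eqP; rewrite eqEdim UH /=; have := rkK U; lia.
Qed.

(** [H :&: H'] has codimension two and lies in [H :&: H''], which has the same
    codimension: the two intersections coincide. *)
Lemma cap_hyperplanes_exchange H H' H'' :
  (\dim H).+1 = n -> (\dim H').+1 = n -> (\dim H'').+1 = n ->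
  H != H' -> H != H'' -> (H :&: H' <= H'')%VS -> (H :&: H'' <= H')%VS.
Proof.
move=> hH hH' hH'' neq' neq'' sub.
suff /eqP <-: (H :&: H' == H :&: H'')%VS by exact: capvSr.
rewrite eqEdim subv_cap capvSl sub /=.
have := rkK (H :&: H')%VS; have := rkK (H :&: H'')%VS.
rewrite !rk_cap_hyperplane //.
have -> : (H <= H')%VS = false.
  by apply: contraNF neq' => /hyperplane_inj ->.
have -> : (H <= H'')%VS = false.
  by apply: contraNF neq'' => /hyperplane_inj ->.
by lia.
Qed.

Lemma subv_bigcap_seqP (s : seq {vspace 'rV[K]_n}) (P : pred {vspace 'rV[K]_n}) U :
  reflect (forall H, H \in s -> P H -> (U <= H)%VS)
          (U <= \bigcap_(H <- s | P H) H)%VS.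
Proof.
elim: s => [|H s IH]; first by rewrite big_nil subvf; left.
rewrite big_cons; case: ifP => PH; last first.
  apply: (iffP IH) => h Z; last by move=> Zs; apply: h; rewrite inE Zs orbT.
  by rewrite inE => /orP[/eqP ->|/h //]; rewrite PH.
rewrite subv_cap; apply: (iffP andP) => [[UH /IH h] Z|h].
  by rewrite inE => /orP[/eqP ->|/h].
split; first by apply: h; rewrite ?inE ?eqxx.
by apply/IH => Z Zs; apply: h; rewrite inE Zs orbT.
Qed.

Lemma bigcap_seq_sub (s : seq {vspace 'rV[K]_n}) (P : pred {vspace 'rV[K]_n}) H :
  H \in s -> P H -> (\bigcap_(Z <- s | P Z) Z <= H)%VS.
Proof. by move: H; apply/subv_bigcap_seqP. Qed.

End Hyperplanes.

(** * The intersection lattice *)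

Section Lattice.

Variables (K : fieldType) (n : nat) (A : {fset {vspace 'rV[K]_n}}).
Hypothesis hA : central_arrangement A.
Implicit Types X Y Z H : {vspace 'rV[K]_n}.

Lemma mem_localization X H :
  (H \in localization A X) = (H \in A) && (X <= H)%VS.
Proof. by rewrite !inE. Qed.

Lemma lattice_bigcap (B : {fset {vspace 'rV[K]_n}}) :
  B `<=` A -> (\bigcap_(H <- enum_fset B) H)%VS \in lattice A.
Proof. by move=> BA; apply/imfsetP; exists B => //=; rewrite fpowersetE. Qed.

(** A flat is the intersection of the hyperplanes that contain it. *)
Lemma lattice_subP X Y : X \in lattice A ->
  reflect (forall H, H \in A -> (X <= H)%VS -> (Y <= H)%VS) (Y <= X)%VS.
Proof.
move=> XL; apply: (iffP idP) => [YX H HA XH|]; first exact: subv_trans XH.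
case/imfsetP: XL => B /=; rewrite fpowersetE => /fsubsetP BA -> h.
apply/subv_bigcap_seqP => H HB _; apply: h; first exact: BA.
exact: bigcap_seq_sub.
Qed.

Lemma hyperplane_in_lattice H : H \in A -> H \in lattice A.
Proof.
move=> HA; have := @lattice_bigcap [fset H]; rewrite fsub1set => /(_ HA).
by rewrite big_seq_fset1.
Qed.

(** The lattice meet is defined through all the flats above X and Y; since
    every flat is an intersection of hyperplanes, only the hyperplanes matter. *)
Lemma sub_lat_meetP X Y U :
  reflect (forall H, H \in A -> (X <= H)%VS -> (Y <= H)%VS -> (U <= H)%VS)
          (U <= lat_meet A X Y)%VS.
Proof.
apply: (iffP (subv_bigcap_seqP _ _ _)) => [h H HA XH YH|h Z ZL /andP[XZ YZ]].
  by apply: h; [exact: hyperplane_in_lattice | rewrite XH].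
apply/lattice_subP => // H HA ZH.
by apply: h => //; [apply: subv_trans ZH | apply: subv_trans ZH].
Qed.

Lemma sub_lat_meetl X Y : (X <= lat_meet A X Y)%VS.
Proof. by apply/sub_lat_meetP. Qed.

Lemma sub_lat_meetr X Y : (Y <= lat_meet A X Y)%VS.
Proof. by apply/sub_lat_meetP. Qed.

Lemma lat_meet_sub X Y H :
  H \in A -> (X <= H)%VS -> (Y <= H)%VS -> (lat_meet A X Y <= H)%VS.
Proof. by move=> HA XH YH; move/sub_lat_meetP: (subvv (lat_meet A X Y)); apply. Qed.

Lemma lattice_proper X Y : Y \in lattice A -> ~~ (X <= Y)%VS ->
  exists2 H, H \in A & (Y <= H)%VS && ~~ (X <= H)%VS.
Proof.
move=> YL nXY.
have [/hasP[H HA hH]|/hasPn h] :=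
  boolP (has (fun H => (Y <= H)%VS && ~~ (X <= H)%VS) (enum_fset A)).
  by exists H.
case/negP: nXY; apply/lattice_subP => // H HA YH.
by have := h H HA; rewrite YH negbK.
Qed.

(** By the dimension formula the rank of the join complements that of the sum,
    and the meet, the smallest flat containing the sum, may be strictly larger
    than the sum. *)
Lemma semimodular X Y :
  rk (lat_join X Y) + rk (lat_meet A X Y) <= rk X + rk Y.
Proof.
have : (X + Y <= lat_meet A X Y)%VS by rewrite subv_add sub_lat_meetl sub_lat_meetr.
move/dimvS; rewrite /lat_join.
have := dimv_sum_cap X Y; have := rkK X; have := rkK Y.
have := rkK (X :&: Y)%VS; have := rkK (lat_meet A X Y); lia.
Qed.

(** * Flags of flats and their parts *)

(** The chain is indexed by natural numbers, only its values up to r being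
    constrained, to allow induction on the index. *)
Variables (r : nat) (X : nat -> {vspace 'rV[K]_n}).
Hypothesis X_lattice : forall i, i <= r -> X i \in lattice A.
Hypothesis X_decr : forall i, i < r -> (X i.+1 <= X i)%VS && (X i.+1 != X i).
Hypothesis X_first : X 0 = fullv.
Hypothesis X_last : X r = lat_top A.

Definition flag_part i := localization A (X i.+1) `\` localization A (X i).

Lemma mem_flag_part i H :
  (H \in flag_part i) = [&& H \in A, (X i.+1 <= H)%VS & ~~ (X i <= H)%VS].
Proof. by rewrite !inE; case: (H \in A); rewrite // andbC. Qed.

Lemma flag_sub i j : i <= j -> j <= r -> (X j <= X i)%VS.
Proof.
elim: j => [|j IH]; first by rewrite leqn0 => /eqP ->.
rewrite leq_eqVlt => /predU1P[-> //|ij] jr.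
by have /andP[/subv_trans -> //] := X_decr jr; apply: IH => //; lia.
Qed.

(** The ranks increase strictly from 0 to r in r steps, so each step is one. *)
Lemma rk_flag i : arr_rank A = r -> i <= r -> rk (X i) = i.
Proof.
move=> rk_last.
have rk_lt j : j < r -> rk (X j) < rk (X j.+1).
  move=> /X_decr /andP[sub neq].
  have: \dim (X j.+1) < \dim (X j).
    by rewrite ltnNge; apply: contra neq => le; rewrite eqEdim sub le.
  have := rkK (X j); have := rkK (X j.+1); lia.
(* Counting strict steps from the bottom, then from the top of the flag. *)
have lower j : j <= r -> j <= rk (X j).
  by elim: j => // j IH jr; apply: leq_ltn_trans (IH (ltnW jr)) (rk_lt j jr).
have upper k : k <= r -> rk (X (r - k)) <= r - k.
  elim: k => [_|k IH kr]; first by rewrite subn0 X_last -[leqRHS]rk_last.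
  have /rk_lt : r - k.+1 < r by lia.
  have -> : (r - k.+1).+1 = r - k by lia.
  have := IH (ltnW kr); lia.
move=> ir; apply/eqP; rewrite eqn_leq lower // andbT.
by have := upper (r - i) (leq_subr _ _); rewrite subKn.
Qed.

Lemma flag_part_cover H : H \in A -> exists2 i, i < r & H \in flag_part i.
Proof.
move=> HA.
have exP : exists i, (X i <= H)%VS.
  by exists r; rewrite X_last; apply: bigcap_seq_sub.
case: (ex_minnP exP) => m XmH mmin.
have rm : m <= r.
  by apply: mmin; rewrite X_last; apply: bigcap_seq_sub.
case: m XmH mmin rm => [|i] XmH mmin rm.
  by move: XmH; rewrite X_first (negPf (hyperplane_neq_fullv (hA HA))).
exists i => //; rewrite mem_flag_part HA XmH /=.
by apply/negP => /mmin; rewrite ltnn.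
Qed.

Lemma flag_part_inj H i j :
  i < r -> j < r -> H \in flag_part i -> H \in flag_part j -> i = j.
Proof.
wlog: i j / i <= j => [hw|ij] ir jr.
  by case: (leqP i j) => [/hw|/ltnW/hw h hi hj]; [apply | symmetry; apply: h].
rewrite !mem_flag_part => /and3P[_ h _] /and3P[_ _ nh].
move: ij; rewrite leq_eqVlt => /predU1P[//|ij].
by case/negP: nh; apply: subv_trans h; apply: flag_sub => //; lia.
Qed.

Lemma flag_part_neq0 i : i < r -> exists H, H \in flag_part i.
Proof.
move=> ir; have /andP[sub neq] := X_decr ir.
have [|H HA /andP[h nh]] := @lattice_proper (X i) (X i.+1) (X_lattice ir).
  by apply: contra neq => sub'; rewrite eqEsubv sub.
by exists H; rewrite mem_flag_part HA h.
Qed.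

(** A section is given here with the part index of each of its members. *)
Lemma section_independent p (s : 'I_p -> {vspace 'rV[K]_n}) (f : 'I_p -> nat) :
  injective f -> (forall a, f a < r) -> (forall a, s a \in flag_part (f a)) ->
  rk (\bigcap_(a < p) s a)%VS = p.
Proof.
move=> f_inj f_lt fs.
(* Restricting to the members of index less than m lets them be intersected
   in increasing order of index. *)
have key m : m <= r ->
    rk (\bigcap_(a < p | f a < m) s a)%VS = #|[pred a | f a < m]|.
  elim: m => [_|m IH mr].
    by rewrite big_pred0 ?rk_fullv ?eq_card0.
  have [a /eqP fa|no] := pickP (fun a => f a == m); last first.
    have E a : (f a < m.+1) = (f a < m) by rewrite ltnS leq_eqVlt no.
    by rewrite (eq_bigl _ _ E) (eq_card (B := [pred a | f a < m])) ?IH 1?ltnW.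
  have E b : (f b < m.+1) && (b != a) = (f b < m).
    by rewrite -(inj_eq f_inj) fa; lia.
  have fam : f a < m.+1 by lia.
  rewrite (bigD1 a) //= (eq_bigl _ _ E) capvC.
  have := fs a; rewrite fa mem_flag_part => /and3P[aA _ nsub].
  rewrite rk_cap_hyperplane ?IH 1?ltnW ?(hA aA) //.
  rewrite (cardD1 a [pred a | f a < m.+1]) inE fam addnC /=; congr (_ + _).
    apply/eqP; rewrite eqb1; apply: contra nsub.
    apply: subv_trans; apply/subv_bigcapP => b fbm.
    have := fs b; rewrite mem_flag_part => /and3P[_ h _].
    by apply: subv_trans h; apply: flag_sub => //; lia.
  by apply: eq_card => b; rewrite !inE andbC E.
have := key r (leqnn r); rewrite (eq_bigl xpredT) // => ->.
by rewrite (eq_card (B := predT)) ?card_ord // => a; rewrite !inE f_lt.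
Qed.

(** * Modular flags have the singleton property *)

(** The part that works is the first one containing a hyperplane above Y. *)
Lemma modular_flag_singleton : arr_rank A = r ->
  (forall i, i <= r -> modular A (X i)) ->
  forall Y, Y \in lattice A -> Y != fullv ->
  exists2 i, i < r & #|` flag_part i `&` localization A Y| = 1.
Proof.
move=> rkA Xmod Y YL Yneq.
have [|H0 H0A /andP[YH0 _]] := @lattice_proper fullv Y YL.
  by apply: contra Yneq => h; rewrite eqEsubv subvf.
have exP : exists i, has (fun H => (X i <= H)%VS && (Y <= H)%VS) (enum_fset A).
  have [i _] := flag_part_cover H0A; rewrite mem_flag_part => /and3P[_ h _].
  by exists i.+1; apply/hasP; exists H0 => //; rewrite h.
case: (ex_minnP exP) => m hm mmin.
have mr : m <= r.
  apply: mmin; have [i ir] := flag_part_cover H0A.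
  rewrite mem_flag_part => /and3P[_ h _].
  apply/hasP; exists H0 => //; rewrite YH0 andbT.
  by apply: subv_trans h; apply: flag_sub.
case: m hm mmin mr => [|i] hm mmin ir.
  case/hasP: hm => H HA; rewrite X_first => /andP[h _].
  by move: h; rewrite (negPf (hyperplane_neq_fullv (hA HA))).
exists i => //.
have disj H : H \in A -> (X i <= H)%VS -> (Y <= H)%VS -> False.
  move=> HA XH YH; have : i < i by apply: mmin; apply/hasP; exists H; rewrite ?XH.
  by rewrite ltnn.
have meet0 : lat_meet A (X i) Y = fullv.
  apply/eqP; rewrite eqEsubv subvf; apply/sub_lat_meetP => H HA XH YH.
  by case: (disj H).
have [_ /(_ Y YL)] := Xmod i (ltnW ir).
have [_ /(_ Y YL)] := Xmod i.+1 ir.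
rewrite meet0 rk_fullv (rk_flag rkA ir) (rk_flag rkA (ltnW ir)) => e1 e0.
have le1 : rk (lat_meet A (X i.+1) Y) <= 1.
  have : rk (lat_join (X i) Y) <= rk (lat_join (X i.+1) Y).
    by apply: rk_sub; rewrite capvS // flag_sub.
  lia.
case/hasP: hm => H HA /andP[XH YH].
apply/eqP/cardfs1P; exists H; apply/fsetP => H'.
rewrite in_fset1 in_fsetI mem_flag_part mem_localization.
apply/idP/eqP => [/andP[/and3P[H'A XH' _] /andP[_ YH']]|->]; last first.
  by rewrite HA XH YH /= !andbT; apply/negP => /disj; apply.
have E Z : Z \in A -> (X i.+1 <= Z)%VS -> (Y <= Z)%VS ->
    lat_meet A (X i.+1) Y = Z.
  by move=> ZA XZ YZ; apply: hyperplane_eq; rewrite ?hA // lat_meet_sub.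
by rewrite -(E H) // -(E H').
Qed.

(** * The singleton property implies modularity *)

(** This is the criterion of Björner, Edelman and Ziegler for supersolvable
    arrangements. *)
Definition flag_exchange := forall i H H', i < r ->
  H \in flag_part i -> H' \in flag_part i -> H != H' ->
  exists2 H'', H'' \in A & (X i <= H'')%VS && (H :&: H' <= H'')%VS.

(** Let j be the index of a part that contains a single hyperplane H'' above
    [H :&: H']. If j exceeded i, then H'' would contain X_j, as
    [H :&: H'] contains X_(i+1); and j = i is excluded by H and H', which are
    two. So j is less than i, and H'' contains X_i. *)
Lemma singleton_flag_exchange :
  (forall Y, Y \in lattice A -> Y != fullv ->
    exists2 i, i < r & #|` flag_part i `&` localization A Y| = 1) ->
  flag_exchange.
Proof.
move=> nice i H H' ir Hi H'i neq.
have HA : H \in A by move: Hi; rewrite mem_flag_part => /and3P[].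
have H'A : H' \in A by move: H'i; rewrite mem_flag_part => /and3P[].
have YL : (H :&: H')%VS \in lattice A.
  have := @lattice_bigcap [fset H; H']; rewrite fsubUset !fsub1set HA H'A.
  by rewrite big_fsetU1 ?inE // big_seq_fset1; apply.
have Yneq : (H :&: H')%VS != fullv.
  apply/negP => /eqP e; have := hyperplane_neq_fullv (hA HA).
  by rewrite -e capvSl.
have [j jr /eqP/cardfs1P[H'' /fsetP e]] := nice _ YL Yneq.
have := e H''; rewrite in_fset1 eqxx in_fsetI mem_flag_part mem_localization.
case/andP=> /and3P[H''A Xj nXj] /andP[_ sub].
exists H'' => //; rewrite sub andbT.
have [ji|ij|ji] := ltngtP j i.
- by apply: subv_trans Xj; apply: flag_sub => //; apply: ltnW.
- case/negP: nXj; apply: subv_trans sub.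
  move: Hi H'i; rewrite !mem_flag_part subv_cap => /and3P[_ XH _] /and3P[_ XH' _].
  have XjXi : (X j <= X i.+1)%VS by apply: flag_sub => //; apply: ltnW.
  by rewrite !(subv_trans XjXi).
- have := e H; have := e H'.
  rewrite !in_fset1 !in_fsetI ji Hi H'i !mem_localization HA H'A capvSl capvSr.
  by move=> /esym/eqP E /esym/eqP E'; rewrite E E' eqxx in neq.
Qed.

(** If H and H' both lie in the part i and contain Y, the hyperplane H'' given
    by the exchange property contains X_i and Y, hence their meet; so inside
    this meet H coincides with [H :&: H''], which lies in H'. *)
Lemma lat_meet_step Y i : flag_exchange -> i < r ->
  lat_meet A (X i.+1) Y = lat_meet A (X i) Y \/
  exists2 H, H \in flag_part i & (Y <= H)%VS /\
    lat_meet A (X i.+1) Y = (lat_meet A (X i) Y :&: H)%VS.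
Proof.
move=> exch ir.
have mono : (lat_meet A (X i.+1) Y <= lat_meet A (X i) Y)%VS.
  apply/sub_lat_meetP => H HA XH; apply: lat_meet_sub => //.
  by apply: subv_trans XH; apply: flag_sub.
have [/hasP[H Hi YH]|/hasPn no] :=
  boolP (has (fun H => (Y <= H)%VS) (enum_fset (flag_part i))); [right|left].
  exists H => //; split=> //.
  move: (Hi); rewrite [_ \in _]mem_flag_part => /and3P[HA XH nXH].
  apply/eqP; rewrite eqEsubv subv_cap mono lat_meet_sub //=.
  apply/sub_lat_meetP => H' H'A XH' YH'.
  have [XiH'|nXiH'] := boolP (X i <= H')%VS.
    by apply: (subv_trans (capvSl _ _)); apply: lat_meet_sub.
  have [<-|neq] := eqVneq H H'; first exact: capvSr.
  have H'i : H' \in flag_part i by rewrite mem_flag_part H'A XH' nXiH'.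
  have [H'' H''A /andP[XH'' sub]] := exch i H H' ir Hi H'i neq.
  have neq'' : H != H'' by apply: contraNneq nXH => ->.
  apply: subv_trans (cap_hyperplanes_exchange (hA HA) (hA H'A) (hA H''A)
    neq neq'' sub).
  rewrite capvC capvS // lat_meet_sub //.
  by apply: subv_trans sub; rewrite subv_cap YH.
apply/eqP; rewrite eqEsubv mono /=.
apply/sub_lat_meetP => H HA XH YH; apply: lat_meet_sub => //.
apply: contraT => nXH; have := no H.
by rewrite [_ \in _]mem_flag_part HA XH nXH YH; apply.
Qed.

(** Semimodularity gives one inequality. The other is proved for the meet of
    X_m and Y in place of Y, by induction on m from i, where that meet contains
    X_i and both sides agree, up to r, where it is Y. *)
Lemma exchange_flag_modular : flag_exchange ->
  forall i, i <= r -> modular A (X i).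
Proof.
move=> exch i ir; split=> [|Y YL]; first exact: X_lattice.
apply/eqP; rewrite eqn_leq semimodular andbT.
suff key m : i <= m -> m <= r ->
    rk (X i) + rk (lat_meet A (X m) Y) <=
    rk (lat_join (X i) (lat_meet A (X m) Y)) + rk (lat_meet A (X i) Y).
  have meetr : lat_meet A (X r) Y = Y.
    apply/eqP; rewrite eqEsubv sub_lat_meetr andbT.
    apply/lattice_subP => // H HA YH; apply: lat_meet_sub => //.
    by rewrite X_last; apply: bigcap_seq_sub.
  by have := key r ir (leqnn r); rewrite meetr.
elim: m => [|m IH]; first by rewrite leqn0 => /eqP -> _;
  rewrite /lat_join (capv_idPl (sub_lat_meetl _ _)).
rewrite leq_eqVlt => /predU1P[<- _|im mr].
  by rewrite /lat_join (capv_idPl (sub_lat_meetl _ _)).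
have := IH im (ltnW mr).
have [-> //|[H Hm [YH ->]]] := lat_meet_step Y exch mr.
move: Hm; rewrite mem_flag_part => /and3P[HA _ nXH].
rewrite /lat_join capvA !(rk_cap_hyperplane _ (hA HA)).
suff -> : (X i :&: lat_meet A (X m) Y <= H)%VS = false by case: (_ <= H)%VS; lia.
apply: contraNF nXH; apply: subv_trans.
by rewrite subv_cap sub_lat_meetl flag_sub // ltnW.
Qed.

End Lattice.

(** * The partition of a maximal chain *)

Theorem theorem1p4 (K : fieldType) (n r : nat)
    (A : {fset {vspace 'rV[K]_n}})
    (C : 'I_r.+1 -> {vspace 'rV[K]_n})
    (hA : central_arrangement A)
    (hr : arr_rank A = r)
    (hC : maximal_chain A C)
    (hC0 : C ord0 = fullv)
    (hCr : C ord_max = lat_top A) :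
  set_partition A (chain_partition A C) /\
  (nice_partition A (chain_partition A C) <-> modular_chain A C).
Proof.
have [[C_lattice C_lt] _] := hC.
pose X i := C (inord i).
have X_lattice i : i <= r -> X i \in lattice A by move=> _; apply: C_lattice.
have X_decr i : i < r -> (X i.+1 <= X i)%VS && (X i.+1 != X i).
  move=> ir; have := C_lt (inord i) (inord i.+1).
  rewrite !inordK ?ltnS // ?(ltnW ir) // => /(_ (ltnSn i)).
  by rewrite /lat_lt /lat_le eq_sym.
have X_first : X 0 = fullv.
  by rewrite -hC0; congr C; apply: val_inj; rewrite /= inordK.
have X_last : X r = lat_top A.
  by rewrite -hCr; congr C; apply: val_inj; rewrite /= inordK.
have partE (i : 'I_r) : chain_part A C i = flag_part A X i.
  rewrite /chain_part /flag_part /X.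
  congr (localization A (C _) `\` localization A (C _));
    by apply: val_inj; rewrite /= inordK // ltnS // ltnW.
have partP B : reflect (exists2 i, i < r & B = flag_part A X i)
                       (B \in chain_partition A C).
  apply: (iffP (imfsetP _ _ _ _)) => [[i _ ->]|[i ir ->]].
    by exists i; rewrite ?partE.
  by exists (Ordinal ir); rewrite ?partE.
have part_of := flag_part_cover hA X_first X_last.
have same_part := flag_part_inj (A := A) X_decr.
have hpart : set_partition A (chain_partition A C).
  split.
  - move=> B /partP[i ir ->]; apply/fset0Pn.
    exact: (flag_part_neq0 X_lattice X_decr).
  - move=> B B' /partP[i ir ->] /partP[j jr ->] neq.
    apply/eqP; apply: contraNT neq => /fset0Pn[H].
    rewrite in_fsetI => /andP[Hi Hj].
    by rewrite (same_part H i j).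
  - apply/fsetP => H; apply/bigfcupP/idP => [[B]|HA].
      rewrite andbT => /partP[i ir ->].
      by rewrite mem_flag_part => /and3P[].
    have [i ir Hi] := part_of H HA.
    by exists (flag_part A X i); rewrite // andbT; apply/partP; exists i.
split=> //; split=> [[_ _ nice] i|modC].
  have exch : flag_exchange A r X.
    apply: singleton_flag_exchange => // Y YL Yneq.
    by have [B /partP[j jr ->] card1] := nice Y YL Yneq; exists j.
  have := exchange_flag_modular hA X_lattice X_decr X_last exch (leq_ord i).
  by rewrite /X inord_val.
split=> //.
  move=> p s [sA s_sep].
  have /fin_all_exists[f fP] : forall a : 'I_p, exists i : nat,
      i < r /\ tnth s a \in flag_part A X i.
    by move=> a; have [i ir Hi] := part_of _ (sA a); exists i.
  apply: (section_independent hA X_decr (f := f)) => [a b fab|a|a];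
    try by case: (fP a).
  apply/eqP; apply: contraT => /s_sep[_ [_ [/partP[i ir ->] /partP[j jr ->]]]].
  have [fa ha] := fP a; have [fb hb] := fP b => neq hai hbj.
  move: neq; rewrite (same_part _ i (f a) _ _ hai ha) //.
  by rewrite (same_part _ j (f b) _ _ hbj hb) // fab eqxx.
move=> Y YL Yneq.
have [|i ir card1] := modular_flag_singleton hA X_decr X_first X_last hr _ YL Yneq.
  by move=> i _; apply: modC.
by exists (flag_part A X i) => //; apply/partP; exists i.
Qed.
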